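(* Assume that $F$ is $\mu$-strongly convex with $\mu>0$, and that $f(\cdot;\xi)$ is $L$-smooth and convex for every realization of $\xi$. Let $w_*$ be the unique minimizer of $F$. Consider the SGD iteration $w_{t+1}=w_t-\eta_t\nabla f(w_t;\xi_t)$, $t=0,1,2,\dots$, with stepsizes such that $\eta_t\le\frac{1}{2L}$, $\eta_t\to0$ as $t\to\infty$, $\frac{d}{dt}\eta_t\le0$, and $\sum_{t=0}^\infty\eta_t=\infty$. Then $$\mathbb{E}[\|w_{t+1}-w_*\|^2]\to0\quad\text{as }t\to\infty.$$
   Context: $\xi$ is a random variable, $f(\cdot;\xi):\mathbb{R}^d\to\mathbb{R}$ is differentiable for every realization of $\xi$, $F(w)=\mathbb{E}[f(w;\xi)]$, and $\mathbb{E}[\nabla f(w;\xi)]=\nabla F(w)$ for every fixed $w\in\mathbb{R}^d$. The norm is Euclidean. $\mu$-strong convexity of $F$: $F(w)-F(w')\ge\langle\nabla F(w'),w-w'\rangle+\frac{\mu}{2}\|w-w'\|^2$ for all $w,w'\in\mathbb{R}^d$. $L$-smoothness of $f(\cdot;\xi)$ (with $L>0$ independent of the realization): $\|\nabla f(w;\xi)-\nabla f(w';\xi)\|\le L\|w-w'\|$ for all $w,w'$. Convexity of $f(\cdot;\xi)$: $f(w;\xi)-f(w';\xi)\ge\langle\nabla f(w';\xi),w-w'\rangle$ for all $w,w'$. The stepsize $\eta_t>0$ is a deterministic function, differentiable in the real variable $t\ge0$, whose values at integers $t$ are used in SGD; $w_0\in\mathbb{R}^d$ is a given (deterministic) initial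 point and $\xi_0,\xi_1,\dots$ are i.i.d. copies of $\xi$. The quantity $N=2\mathbb{E}[\|\nabla f(w_*;\xi)\|^2]$ is assumed finite. *)

(* Defs.v *)
From HB Require Import structures.
From mathcomp Require Export all_boot all_order all_algebra finmap.
From mathcomp Require Export all_classical all_reals all_analysis.

Set Implicit Arguments.
Unset Strict Implicit.
Unset Printing Implicit Defensive.

Export Order.TTheory GRing.Theory Num.Theory.
Export numFieldNormedType.Exports.

Local Open Scope classical_set_scope.
Local Open Scope ring_scope.

(* The library norm [`|u|] on ['rV[R]_d] is the max norm.  It induces the
   topology, hence it can be used for differentiability, but the Euclidean norm
   has to be defined separately. *)
Definition dot (R : realType) (d : nat) (u v : 'rV[R]_d) : R :=
  \sum_(i < d) u 0 i * v 0 i.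

Definition enorm (R : realType) (d : nat) (u : 'rV[R]_d) : R :=
  Num.sqrt (dot u u).

Definition grad (R : realType) (d : nat) (g : 'rV[R]_d -> R) (w : 'rV[R]_d) :
    'rV[R]_d :=
  \row_(i < d) 'D_(delta_mx 0 i) g w.

Definition strongly_convex (R : realType) (d : nat) (mu : R)
    (g : 'rV[R]_d -> R) : Prop :=
  forall w w' : 'rV[R]_d,
    g w - g w' >= dot (grad g w') (w - w') + mu / 2 * enorm (w - w') ^+ 2.

Definition grad_convex (R : realType) (d : nat) (g : 'rV[R]_d -> R) : Prop :=
  forall w w' : 'rV[R]_d, g w - g w' >= dot (grad g w') (w - w').

Definition smooth (R : realType) (d : nat) (L : R) (g : 'rV[R]_d -> R) : Prop :=
  forall w w' : 'rV[R]_d, enorm (grad g w - grad g w') <= L * enorm (w - w').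

(* Derivative of a real function relative to a domain [D]: at a boundary point
   of an interval [D] it is the one-sided derivative. *)
Definition has_derivative_within (R : realType) (D : set R) (g : R -> R)
    (t l : R) : Prop :=
  (g s - g t) / (s - t) @[s --> within D t^'] --> l.

(* Mutual independence: the product rule holds on every finite subfamily. *)
Definition mutually_independent (dO dT : measure_display)
    (Omega : measurableType dO) (T : measurableType dT) (R : realType)
    (P : probability Omega R) (I : choiceType) (X : I -> {RV P >-> T}) : Prop :=
  forall (J : {fset I}) (A : I -> set T), (forall i, measurable (A i)) ->
    P (\bigcap_(i in [set` J]) (X i @^-1` A i)) =
    (\prod_(i <- J) P (X i @^-1` A i))%E.

Definition iid_copies (dO dT : measure_display)
    (Omega : measurableType dO) (T : measurableType dT) (R : realType)
    (P : probability Omega R) (I : choiceType) (X : I -> {RV P >-> T})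
    (Y : {RV P >-> T}) : Prop :=
  mutually_independent X /\
  forall (i : I) (A : set T), measurable A ->
    distribution P (X i) A = distribution P Y A.

(* Main.v *)
(* Write a_t for the expectation of |w_t - ws|^2.  The iterate w_t is measurable
   for the sigma-algebra generated by xi_0, ..., xi_{t-1}, which is independent
   of xi_t, so by Tonelli the expectation of |w_{t+1} - ws|^2 may be computed by
   freezing w_t = v and integrating over xi first.  Smoothness gives
   |grad f v|^2 <= 2 L^2 |v - ws|^2 + 2 |grad f ws|^2, and strong convexity,
   used only against the minimizer, gives
   <grad F v, v - ws> >= mu/2 |v - ws|^2; hence
     a_{t+1} <= (1 - mu eta_t + 2 L^2 eta_t^2) a_t + N eta_t^2.
   This is cruder than the bound obtained from co-coercivity, but since
   eta_t -> 0 the factor is eventually at most 1 - (mu/2) eta_t, and the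
   divergence of the sum of the eta_t then forces a_t -> 0. *)
Require Import Defs.
From mathcomp Require Import measurable_realfun.
From mathcomp Require Import ring lra.

Set Implicit Arguments.
Unset Strict Implicit.
Unset Printing Implicit Defensive.

Local Open Scope classical_set_scope.
Local Open Scope ring_scope.

(** * Independence and product laws *)

(** For fixed [B] both sides are finite measures in [A], the left one being the law of [X] under [P]
    restricted to the event that [Y] lies in [B]. They agree on a pi-system containing the whole
    space, so uniqueness of measures applies. *)
Lemma indep_generated (R : realType) (d d1 d2 : measure_display)
  (Om : measurableType d) (S : measurableType d1) (T : measurableType d2)
  (P : probability Om R) (X : {RV P >-> S}) (Y : {RV P >-> T})
  (G : set (set S)) (mG : measurable = <<s G >>) (GI : setI_closed G)
  (GT : G setT)
  (XY : forall A B, G A -> measurable B ->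
    P (X @^-1` A `&` Y @^-1` B) = (P (X @^-1` A) * P (Y @^-1` B))%E)
  (A : set S) (B : set T) (mA : measurable A) (mB : measurable B) :
  P (X @^-1` A `&` Y @^-1` B) = (P (X @^-1` A) * P (Y @^-1` B))%E.
Proof.
have mYB : measurable (Y @^-1` B) by exact: measurable_funPTI.
pose k := NngNum (fine_ge0 (measure_ge0 P (Y @^-1` B))).
have kE C : mscale k (distribution P X) C =
    (P (X @^-1` C) * P (Y @^-1` B))%E.
  by rewrite /mscale/= fineK ?fin_num_measure// muleC.
rewrite -kE; apply: (@measure_unique _ _ _ G (fun=> setT) mG GI (fun=> GT) _
  (pushforward (mrestr P mYB) X) (mscale k (distribution P X)) _ _ A mA) => //.
- by apply/seteqP; split => // x _; exists 0%N.
- by move=> C GC; exact: etrans (XY _ _ GC mB) (esym (kE C)).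
- move=> _; rewrite /= /pushforward /mrestr preimage_setT.
  by rewrite setTI ltey_eq fin_num_measure.
Qed.

(** Independence makes the joint law of [X] and [Y] the product of their laws; Tonelli then allows
    [X] to be frozen while [y] is integrated out. *)
Lemma integral_indep (R : realType) (d d1 d2 : measure_display)
  (Om : measurableType d) (S : measurableType d1) (T : measurableType d2)
  (P : probability Om R) (X : {RV P >-> S}) (Y : {RV P >-> T})
  (XY : forall A B, measurable A -> measurable B ->
    P (X @^-1` A `&` Y @^-1` B) = (P (X @^-1` A) * P (Y @^-1` B))%E)
  (h : S * T -> \bar R) (mh : measurable_fun [set: S * T] h)
  (h0 : forall z, (0 <= h z)%E) :
  (\int[P]_om h (X om, Y om) =
   \int[P]_om \int[distribution P Y]_y h (X om, y))%E.
Proof.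
have mXY : measurable_fun setT (fun om => (X om, Y om)).
  by apply: measurable_fun_pair.
transitivity (\int[pushforward P (fun om => (X om, Y om))]_z h z)%E.
  by rewrite ge0_integral_pushforward.
transitivity (\int[distribution P X \x distribution P Y]_z h z)%E.
  apply: eq_measure_integral => A mA _.
  symmetry; apply: (product_measure_unique
    (m' := pushforward P (fun om => (X om, Y om)))) => //.
rewrite fubini_tonelli1// ge0_integral_pushforward//.
  exact: measurable_fun_fubini_tonelli_F.
by move=> x _; exact: integral_ge0.
Qed.

(** * Measurability of Carathéodory functions *)

Lemma mx_norm_ler (R : realType) (n : nat) (u : 'rV[R]_n) (e : R) :
  0 <= e -> (forall i, `|u 0 i| <= e) -> `|u| <= e.
Proof.
move=> e0 ue; rewrite [leLHS]mx_normrE; apply: bigmax_le => // -[i j] _ /=.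
by rewrite ord1.
Qed.

(** Serves to evaluate a random gradient at a random iterate: continuity in the first argument makes
    the composite a pointwise limit of maps whose first argument takes countably many values. *)
Lemma measurable_carath (R : realType) (n : nat) (dS dT : measure_display)
  (S : measurableType dS) (T : measurableType dT)
  (g : 'rV[R]_n -> T -> R)
  (mg : forall v, measurable_fun setT (g v))
  (cg : forall x, continuous (g ^~ x))
  (v : S -> 'rV[R]_n) (mv : forall i, measurable_fun setT (fun s => v s 0 i))
  (X : S -> T) (mX : measurable_fun setT X) :
  measurable_fun setT (fun s => g (v s) (X s)).
Proof.
(* Rounding v down to the grid of mesh 1/(k+1) makes it countably valued. *)
pose q k s : 'rV[int]_n := \row_i Num.floor (k.+1%:R * v s 0 i).
pose r k (a : 'rV[int]_n) : 'rV[R]_n := \row_i ((a 0 i)%:~R / k.+1%:R).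
apply: (@measurable_fun_cvg _ _ _ _ (fun k s => g (r k (q k s)) (X s))).
  move=> k _ B mB; rewrite setTI.
  (* Split according to the grid point [a]: on each piece the first argument is the constant
     [r k a]. *)
  have -> : (fun s => g (r k (q k s)) (X s)) @^-1` B =
      \bigcup_a ([set s | q k s = a] `&` (fun s => g (r k a) (X s)) @^-1` B).
    apply/seteqP; split=> [s /= Bs|s /= [a _ [<-]//]].
    by exists (q k s).
  apply: countable_bigcupT_measurable; first exact: countableP.
  move=> a; apply: measurableI; last first.
    rewrite -[X in measurable X]setTI.
    exact: (measurableT_comp (mg _) mX).
  have -> : [set s | q k s = a] =
      \bigcap_i (fun s => k.+1%:R * v s 0 i) @^-1`
        `[(a 0 i)%:~R, (a 0 i + 1)%:~R[%classic.
    apply/seteqP; split=> [s /= <- i _|s /= h].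
      by rewrite /= in_itv /= !mxE floor_itv.
    apply/rowP => i; rewrite mxE; apply: floor_def.
    by have := h i I; rewrite /= in_itv.
  apply: fin_bigcap_measurable => // i _.
  rewrite -[X in measurable X]setTI.
  by apply: measurable_funM => //.
move=> s _.
apply: (@cvg_comp _ _ _ (fun k => r k (q k s)) (g ^~ (X s)) _ (nbhs (v s))).
  2: exact: cg.
apply/cvgrPdist_le => /= e e0.
near=> k.
apply: mx_norm_ler => [|i]; first exact: ltW.
rewrite !mxE.
have /andP[h1 h2] := floor_itv (k.+1%:R * v s 0 i).
have -> : v s 0 i - (Num.floor (k.+1%:R * v s 0 i))%:~R / k.+1%:R =
   (k.+1%:R * v s 0 i - (Num.floor (k.+1%:R * v s 0 i))%:~R) / k.+1%:R.
  by rewrite mulrBl mulrAC divff ?mul1r// gt_eqF.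
rewrite ger0_norm; last by rewrite divr_ge0// subr_ge0.
apply: (@le_trans _ _ (k.+1%:R^-1)).
  by rewrite ler_piMl// lerBlDr addrC ltW// -[X in _ + X]/(1%:~R) -intrD.
apply: ltW; near: k; exact: (near_infty_natSinv_lt (PosNum e0)).
Unshelve. all: by end_near. Qed.

(** * Euclidean norm and its comparison with the max norm *)

Lemma dot_ge0 (R : realType) (n : nat) (u : 'rV[R]_n) : 0 <= dot u u.
Proof. by apply: sumr_ge0 => i _; rewrite -expr2 sqr_ge0. Qed.

Lemma enorm_sqr (R : realType) (n : nat) (u : 'rV[R]_n) :
  enorm u ^+ 2 = dot u u.
Proof. by rewrite sqr_sqrtr// dot_ge0. Qed.

Lemma enormN (R : realType) (n : nat) (u : 'rV[R]_n) : enorm (- u) = enorm u.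
Proof.
by congr Num.sqrt; apply: eq_bigr => i _; rewrite !mxE mulrNN.
Qed.

Lemma ler_coord_enorm (R : realType) (n : nat) (u : 'rV[R]_n) (i : 'I_n) :
  `|u 0 i| <= enorm u.
Proof.
rewrite -sqrtr_sqr ler_wsqrtr// /dot (bigD1 i)//= expr2 lerDl.
by apply: sumr_ge0 => j _; rewrite -expr2 sqr_ge0.
Qed.

Lemma enorm_ler (R : realType) (n : nat) (u : 'rV[R]_n) :
  enorm u <= Num.sqrt n%:R * `|u|.
Proof.
rewrite -[X in _ * X]ger0_norm// -(sqrtr_sqr `|u|) -sqrtrM// ler_wsqrtr//.
rewrite mulr_natl -[X in _ *+ X]card_ord -sumr_const ler_sum// => i _.
rewrite -expr2 -real_normK ?num_real// ler_pXn2r// ?nnegrE//.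
have := @le_bigmax _ _ _ 0 (fun ij : 'I_1 * 'I_n => `|u ij.1 ij.2|) (0, i).
by rewrite [X in _ <= X -> _](_ : _ = `|u|)// [RHS]mx_normrE.
Qed.

Lemma enorm_sub_sqr (R : realType) (n : nat) (u g : 'rV[R]_n) (e : R) :
  enorm (u - e *: g) ^+ 2 =
  enorm u ^+ 2 - 2 * e * dot u g + e ^+ 2 * enorm g ^+ 2.
Proof.
rewrite !enorm_sqr /dot !mulr_sumr -sumrB -big_split/=.
by apply: eq_bigr => i _; rewrite !mxE; ring.
Qed.

Lemma enormD_sqr_le (R : realType) (n : nat) (u v : 'rV[R]_n) :
  enorm (u + v) ^+ 2 <= 2 * enorm u ^+ 2 + 2 * enorm v ^+ 2.
Proof.
rewrite !enorm_sqr /dot !mulr_sumr -big_split/= ler_sum// => i _.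
by rewrite !mxE; have := sqr_ge0 (u 0 i - v 0 i); rewrite expr2; lra.
Qed.

(** * Continuity and measurability of gradients *)

(** The Lipschitz bound is Euclidean while the topology comes from the max norm; comparing the two
    norms costs a factor [Num.sqrt n%:R]. *)
Lemma smooth_grad_continuous (R : realType) (n : nat) (L : R)
  (g : 'rV[R]_n -> R) (i : 'I_n) :
  0 < L -> smooth L g -> continuous (fun v => grad g v 0 i).
Proof.
move=> L0 gL v; apply/(@cvgrPdist_le _ _ _ (nbhs v)) => /= e e0.
(* The summand 1 keeps the constant positive when [n] is 0. *)
have K0 : 0 < L * Num.sqrt n%:R + 1 by rewrite ltr_wpDl// mulr_ge0// ltW.
near=> w.
have -> : grad g v 0 i - grad g w 0 i = (grad g v - grad g w) 0 i.
  by rewrite !mxE.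
apply: (le_trans (ler_coord_enorm _ _)); apply: (le_trans (gL _ _)).
apply: (@le_trans _ _ ((L * Num.sqrt n%:R + 1) * `|v - w|)).
  rewrite mulrDl mul1r -mulrA ler_wpDr//.
  apply: ler_wpM2l; first exact: ltW.
  exact: enorm_ler.
rewrite -ler_pdivlMl//.
near: w; apply: (@cvgr_dist_le _ _ _ _ _ id v (@cvg_id _ (nbhs v))).
by rewrite mulr_gt0// invr_gt0.
Unshelve. all: by end_near. Qed.

(** A partial derivative is the pointwise limit of the difference quotients with steps 1/(k+1), each
    measurable in [x]. *)
Lemma measurable_grad (R : realType) (n : nat) (d : measure_display)
  (T : measurableType d) (f : 'rV[R]_n -> T -> R)
  (mf : forall w, measurable_fun setT (f w))
  (df : forall x w, differentiable (f ^~ x) w) (v : 'rV[R]_n) (i : 'I_n) :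
  measurable_fun setT (fun x => grad (f ^~ x) v 0 i).
Proof.
pose u : 'rV[R]_n := delta_mx 0 i.
apply: (@measurable_fun_cvg _ _ _ _
  (fun k x => k.+1%:R * (f (k.+1%:R^-1 *: u + v) x - f v x))).
  move=> k; apply: measurable_funM => //; exact: measurable_funB.
move=> x _; rewrite mxE.
have dv : derivable (f ^~ x) v u by apply: diff_derivable.
have h0 : (k.+1%:R^-1 : R) @[k --> \oo] --> 0^'.
  move=> B /(@cvg_harmonic R) hB.
  apply: (@filterS _ \oo _ (fun k => (k.+1%:R^-1 : R) != 0 -> B k.+1%:R^-1)) hB.
  by move=> k; apply; rewrite invr_eq0.
have := cvg_comp _ _ h0 dv.
by under [X in X @ _ --> _ -> _]eq_fun do rewrite /= invrK.
Qed.

Lemma measurable_enorm_sqr (R : realType) (n : nat) (d : measure_display)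
  (T : measurableType d) (u : T -> 'rV[R]_n)
  (mu : forall i, measurable_fun setT (fun x => u x 0 i)) :
  measurable_fun setT (fun x => enorm (u x) ^+ 2).
Proof.
under eq_fun do rewrite enorm_sqr /dot.
by apply: measurable_sum => i; exact: measurable_funM.
Qed.

(** * Mean effect of one SGD step from a frozen point *)

(** In the expanded square the cross term is linear in the gradient, so its mean is known, and the
    quadratic term is compared with the gradient at [ws] through [gL]. *)
Lemma mean_sgd_step (R : realType) (n : nat) (d : measure_display)
  (T : measurableType d) (Q : probability T R)
  (g : 'rV[R]_n -> T -> 'rV[R]_n) (ws v m : 'rV[R]_n) (L e q : R)
  (mg : forall w i, measurable_fun setT (fun x => g w x 0 i))
  (gL : forall x, enorm (g v x - g ws x) <= L * enorm (v - ws))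
  (gsE : (\int[Q]_x (enorm (g ws x) ^+ 2)%:E = q%:E)%E)
  (gvE : forall i, (\int[Q]_x (g v x 0 i)%:E = (m 0 i)%:E)%E) :
  (\int[Q]_x (enorm (v - e *: g v x - ws) ^+ 2)%:E <=
   ((1 + 2 * e ^+ 2 * L ^+ 2) * enorm (v - ws) ^+ 2
    - 2 * e * dot (v - ws) m + 2 * e ^+ 2 * q)%:E)%E.
Proof.
set u := v - ws.
have gv_le x : enorm (g v x) ^+ 2 <=
    2 * L ^+ 2 * enorm u ^+ 2 + 2 * enorm (g ws x) ^+ 2.
  rewrite -[in leLHS](subrK (g ws x) (g v x)).
  apply: (le_trans (enormD_sqr_le _ _)); rewrite lerD2r -mulrA ler_pM2l//.
  rewrite -exprMn ler_pXn2r// ?nnegrE ?sqrtr_ge0//.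
  exact: le_trans (sqrtr_ge0 _) (gL x).
have igs : Q.-integrable setT (fun x => (enorm (g ws x) ^+ 2)%:E).
  apply/integrableP; split; first exact/measurable_EFinP/measurable_enorm_sqr.
  under eq_integral do rewrite gee0_abs ?lee_fin ?sqr_ge0//.
  by rewrite gsE ltry.
have igv i : Q.-integrable setT (fun x => (g v x 0 i)%:E).
  (* Domination through y <= 1 + y^2, applied to y = [enorm (g v x)] and combined with [gv_le]. *)
  apply: (@le_integrable _ _ _ _ _ _ _
    (fun x => (1 + 2 * L ^+ 2 * enorm u ^+ 2)%:E +
              2%:E * (enorm (g ws x) ^+ 2)%:E)%E) => //.
  - exact/measurable_EFinP.
  - move=> x _; rewrite -EFinM -EFinD !abse_EFin lee_fin.
    apply: le_trans (ler_norm _).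
    have := ler_coord_enorm (g v x) i; have := gv_le x.
    set y := enorm (g v x); have := sqr_ge0 (y - 1).
    by have := sqr_ge0 y; rewrite sqrrB1; lra.
  - apply: integrableD => //; first exact: finite_measure_integrable_cst.
    exact: integrableZl.
(* A pointwise majorant of the squared distance whose integral is computed term by term; the inner
   product is spread over coordinates because the mean gradient is given coordinatewise. *)
pose h x := (((1 + 2 * e ^+ 2 * L ^+ 2) * enorm u ^+ 2)%:E +
  ((2 * e ^+ 2)%:E * (enorm (g ws x) ^+ 2)%:E +
   \sum_(i < n) (- (2 * e * u 0 i))%:E * (g v x 0 i)%:E))%E.
have ih : Q.-integrable setT h.
  apply: integrableD => //; first exact: finite_measure_integrable_cst.
  apply: integrableD => //; first exact: integrableZl.
  by apply: integrable_sum => // i _; exact: integrableZl.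
have -> : ((1 + 2 * e ^+ 2 * L ^+ 2) * enorm u ^+ 2 -
    2 * e * dot u m + 2 * e ^+ 2 * q)%:E = (\int[Q]_x h x)%E.
  rewrite integralD//; last 2 first.
    exact: finite_measure_integrable_cst.
    apply: integrableD => //; first exact: integrableZl.
    by apply: integrable_sum => // i _; exact: integrableZl.
  rewrite integral_cst//= probability_setT mule1 integralD//; last 2 first.
    exact: integrableZl.
    by apply: integrable_sum => // i _; exact: integrableZl.
  rewrite integralZl// gsE integral_sum//; last by move=> i; exact: integrableZl.
  under eq_bigr do rewrite integralZl// gvE.
  under eq_bigr do rewrite -EFinM.
  rewrite sumEFin -EFinM -!EFinD; congr EFin.
  rewrite -addrA; congr (_ + _); rewrite addrC; congr (_ + _).
  rewrite /dot mulr_sumr -sumrN; apply: eq_bigr => i _; ring.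
apply: ge0_le_integral => //.
- by move=> x _; rewrite lee_fin sqr_ge0.
- apply/measurable_EFinP/measurable_enorm_sqr => i.
  under eq_fun do rewrite !mxE.
  apply: measurable_funB => //; apply: measurable_funB => //.
  exact: measurable_funM.
- exact: measurable_int ih.
- move=> x _; rewrite /h.
  under eq_bigr do rewrite -EFinM.
  rewrite sumEFin -EFinM -!EFinD lee_fin.
  rewrite addrAC enorm_sub_sqr -/u.
  have -> : \sum_(i < n) - (2 * e * u 0 i) * g v x 0 i =
      - (2 * e * dot u (g v x)).
    by rewrite /dot mulr_sumr -sumrN; apply: eq_bigr => i _; ring.
  have := ler_wpM2l (sqr_ge0 e) (gv_le x); lra.
Qed.

(** * A contraction recursion with divergent total step *)

Lemma divergent_series_contraction (R : realType) (a eta : nat -> R) (k N : R) :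
  0 < k -> (forall t, 0 <= a t) -> (forall t, 0 < eta t) ->
  eta t @[t --> \oo] --> (0 : R) -> (\sum_(0 <= t <oo) (eta t)%:E = +oo)%E ->
  (\forall t \near \oo, a t.+1 <= (1 - k * eta t) * a t + eta t ^+ 2 * N) ->
  a t @[t --> \oo] --> (0 : R).
Proof.
move=> k0 a0 eta0 etac etas rec; apply/cvgrPdist_le => /= e e0.
have ke0 : 0 < k * e / 2 by rewrite divr_gt0// mulr_gt0.
(* From [T0] on, the noise is at most half of the decrease [k * eta t * e] available at level [e],
   and the contraction factor is nonnegative. *)
have [T0 _ h] : \forall t \near \oo,
    a t.+1 <= a t - k * eta t * a t + eta t * (k * e / 2) /\ k * eta t <= 1.
  near=> t.
  have h1 : `|0 - eta t| <= k^-1.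
    by near: t; apply: cvgr_dist_le => //; rewrite invr_gt0.
  (* [N] may have any sign, hence the positive denominator [|N| + 1]. *)
  have h2 : `|0 - eta t| <= k * e / 2 / (`|N| + 1).
    by near: t; apply: cvgr_dist_le => //; rewrite divr_gt0// ltr_wpDl.
  move: h1 h2; rewrite sub0r normrN gtr0_norm// => h1 h2; split; last first.
    by rewrite -ler_pdivlMl ?mulr1.
  rewrite ler_pdivlMr ?ltr_wpDl// in h2.
  have h3 : eta t * N <= k * e / 2.
    apply: le_trans h2; apply: ler_wpM2l; first exact: ltW.
    by apply: (le_trans (ler_norm N)); rewrite lerDl.
  have h4 : a t.+1 <= (1 - k * eta t) * a t + eta t ^+ 2 * N by near: t.
  apply: (le_trans h4).
  have : eta t * (eta t * N) <= eta t * (k * e / 2) by rewrite ler_wpM2l// ltW.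
  rewrite expr2; lra.
(* If a stayed above e, each step would decrease it by at least (k e / 2) eta t,
   contradicting the divergence; once a is below e it stays there. *)
have [t1 Tt1 at1] : exists2 t, (T0 <= t)%N & a t <= e.
  apply: contrapT => /forall2NP ne.
  have ae t : (T0 <= t)%N -> e < a t.
    by move=> Tt; have [//|/negP] := ne t; rewrite -ltNge.
  have dec n : a (T0 + n)%N + k * e / 2 * \sum_(T0 <= t < T0 + n) eta t <= a T0.
    elim: n => [|n IH]; first by rewrite addn0 big_geq// mulr0 addr0.
    have Tn : (T0 <= T0 + n)%N by exact: leq_addr.
    have [r1 _] := h _ Tn.
    rewrite addnS big_nat_recr//= mulrDr.
    have := ae _ Tn; set x := a (T0 + n)%N in r1 IH *.
    move=> ex; have : k * eta (T0 + n)%N * e <= k * eta (T0 + n)%N * x.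
      by rewrite ler_wpM2l// ltW// mulr_gt0.
    by move: IH r1; lra.
  (* Since [a] is nonnegative, [dec] bounds the terms from [T0] on by the first summand; the second
     is the initial segment. *)
  pose M := a T0 / (k * e / 2) + \sum_(0 <= t < T0) eta t.
  have : (\sum_(0 <= t <oo) (eta t)%:E <= M%:E)%E.
    apply: lime_le.
      by apply: is_cvg_nneseries => t _ _; rewrite lee_fin ltW.
    near=> n; have Tn : (T0 <= n)%N by near: n; exact: nbhs_infty_ge.
    rewrite sumEFin lee_fin (big_cat_nat _ Tn)//= /M addrC lerD2r.
    rewrite ler_pdivlMr// mulrC -(subnKC Tn).
    by apply: le_trans (dec (n - T0)%N); rewrite lerDr.
  by rewrite etas leye_eq.
near=> t; rewrite sub0r normrN ger0_norm//.
have tt1 : (t1 <= t)%N by near: t; exact: nbhs_infty_ge.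
rewrite -(subnKC tt1); elim: (t - t1)%N => [|n IH]; first by rewrite addn0.
rewrite addnS.
have [r1 r2] := h _ (leq_trans Tt1 (leq_addr n t1)).
apply: (le_trans r1); move: IH r2; set x := a _ => IH r2.
(* With x <= e the next value is at most e - k eta e + k eta e / 2, hence at most e. *)
have h3 : 0 <= (1 - k * eta (t1 + n)%N) * (e - x).
  by rewrite mulr_ge0// subr_ge0.
have h4 : 0 <= k * eta (t1 + n)%N * e by rewrite !mulr_ge0// ltW.
lra.
Unshelve. all: by end_near. Qed.

(** * The sigma-algebra of the past samples *)

(* The pi-system generating the sigma-algebra of X_0, ..., X_{t-1}; [Om] carries
   that sigma-algebra through [g_sigma_algebraType]. *)
Definition past_cylinders (Om : Type) (d : measure_display)
    (T : measurableType d) (X : nat -> Om -> T) (t : nat) : set (set Om) :=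
  [set C | exists2 A : nat -> set T, (forall i, measurable (A i)) &
    C = \bigcap_(i in `I_t) (X i @^-1` A i)].

Lemma past_cylinders_setI (Om : Type) (d : measure_display)
  (T : measurableType d) (X : nat -> Om -> T) (t : nat) :
  setI_closed (past_cylinders X t).
Proof.
move=> _ _ [A mA ->] [B mB ->]; exists (fun i => A i `&` B i).
  by move=> i; exact: measurableI.
by rewrite -bigcapI; apply: eq_bigcapr => i _; rewrite preimage_setI.
Qed.

Lemma past_cylinders_setT (Om : Type) (d : measure_display)
  (T : measurableType d) (X : nat -> Om -> T) (t : nat) :
  past_cylinders X t setT.
Proof.
exists (fun=> setT) => //; apply/seteqP; split => // om _ i _.
Qed.

Lemma past_cylindersS (Om : Type) (d : measure_display)
  (T : measurableType d) (X : nat -> Om -> T) (t : nat) :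
  past_cylinders X t `<=` past_cylinders X t.+1.
Proof.
move=> _ [A mA ->]; exists (fun i => if (i < t)%N then A i else setT).
  by move=> i; case: ifP.
apply/seteqP; split => om /= h i /= it.
  by case: ifP => // ?; exact: h.
by have := h i (ltnW it : (i < t.+1)%N); rewrite it.
Qed.

(** Level [t] records only the indices below [t], so [X t] appears at level [t.+1]; its preimages
    are cylinders with all other coordinates free. *)
Lemma measurable_past (Om : pointedType) (d : measure_display)
  (T : measurableType d) (X : nat -> Om -> T) (t : nat) :
  measurable_fun [set: g_sigma_algebraType (past_cylinders X t.+1)] (X t).
Proof.
move=> _ B mB; rewrite setTI; apply: sub_gen_smallest.
exists (fun i => if i == t then B else setT).
  by move=> i; case: ifP.
apply/seteqP; split => om /= h.
  by move=> i it /=; case: ifP => // /eqP ->.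
by have := h t (ltnSn t); rewrite /= eqxx.
Qed.

Lemma measurable_fun_pastS (Om : pointedType) (d d' : measure_display)
  (T : measurableType d) (U : measurableType d') (X : nat -> Om -> T)
  (t : nat) (h : Om -> U) :
  measurable_fun [set: g_sigma_algebraType (past_cylinders X t)] h ->
  measurable_fun [set: g_sigma_algebraType (past_cylinders X t.+1)] h.
Proof.
move=> mh _ B mB; have := mh measurableT B mB; rewrite !setTI.
move: (h @^-1` B); apply: sub_smallest2r; last exact: past_cylindersS.
exact: smallest_sigma_algebra.
Qed.

(** Says that the past is a sub-sigma-algebra, in a form that turns the whole history into a random
    variable: the identity into the coarser space. *)
Lemma measurable_past_id (dO d : measure_display)
  (Om : measurableType dO) (T : measurableType d) (X : nat -> {mfun Om >-> T})
  (t : nat) :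
  measurable_fun [set: Om]
    (id : Om -> g_sigma_algebraType (past_cylinders X t)).
Proof.
move=> _ B mB; rewrite setTI preimage_id; move: B mB.
apply: smallest_sub; first exact: sigma_algebra_measurable.
move=> _ [A mA ->]; apply: fin_bigcap_measurable; first exact: finite_II.
by move=> i _; exact: measurable_funPTI.
Qed.

Lemma indep_past (dO dT : measure_display) (Omega : measurableType dO)
  (T : measurableType dT) (R : realType) (P : probability Omega R)
  (X : nat -> {RV P >-> T}) (t : nat) (C : set Omega) (B : set T) :
  mutually_independent X -> past_cylinders X t C -> measurable B ->
  P (C `&` X t @^-1` B) = (P C * P (X t @^-1` B))%E.
Proof.
move=> indX [A mA ->] mB.
(* Overriding index [t] leaves the cylinder over indices below [t] unchanged and makes the joint
   event a cylinder over [t.+1] indices. *)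
pose A' i := if i == t then B else A i.
have mA' i : measurable (A' i) by rewrite /A'; case: ifP.
have prodE s A0 : (forall i, measurable (A0 i)) ->
    P (\bigcap_(i in `I_s) X i @^-1` A0 i) =
    (\prod_(i < s) P (X i @^-1` A0 i))%E.
  move=> mA0; rewrite -(big_mkord xpredT (fun i => P (X i @^-1` A0 i))).
  pose J := [fset i in iota 0 s]%fset.
  have JE i : (i \in J) = (i < s)%N by rewrite inE mem_iota.
  have -> : `I_s = [set` J] by apply/seteqP; split => i; rewrite /= JE.
  rewrite indX//; apply: perm_big; apply: uniq_perm => [||i].
  - exact: fset_uniq.
  - exact: iota_uniq.
  - by rewrite JE mem_index_iota.
have -> : \bigcap_(i in `I_t) X i @^-1` A i `&` X t @^-1` B =
    \bigcap_(i in `I_t.+1) X i @^-1` A' i.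
  apply/seteqP; split => om /=.
    move=> [h Bt] i; rewrite /= ltnS /A' => it.
    by case: eqVneq => [->//|ne]; apply: h; rewrite /= ltn_neqAle ne.
  move=> h; split; last by have := h t (ltnSn t); rewrite /= /A' eqxx.
  by move=> i /= it; have := h i (ltnW it); rewrite /= /A' lt_eqF.
have -> : \bigcap_(i in `I_t) X i @^-1` A i =
    \bigcap_(i in `I_t) X i @^-1` A' i.
  by apply: eq_bigcapr => i /= it; rewrite /A' lt_eqF.
have A't : A' t = B by rewrite /A' eqxx.
by rewrite !prodE// big_ord_recr/= A't.
Qed.

(** The history, seen as the identity into the past sigma-algebra, is independent of [X t]: this
    holds on cylinders and extends by [indep_generated]. *)
Lemma integral_indep_past (dO dT : measure_display) (Omega : measurableType dO)
  (T : measurableType dT) (R : realType) (P : probability Omega R)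
  (X : nat -> {RV P >-> T}) (t : nat)
  (h : g_sigma_algebraType (past_cylinders X t) * T -> \bar R) :
  mutually_independent X -> measurable_fun setT h ->
  (forall z, (0 <= h z)%E) ->
  (\int[P]_om h (om, X t om) =
   \int[P]_om \int[distribution P (X t)]_y h (om, y))%E.
Proof.
move=> indX mh h0.
pose S := g_sigma_algebraType (past_cylinders X t).
pose Y : {RV P >-> S} := mfun_Sub (mem_set (@measurable_past_id _ _ _ _ X t)).
apply: (@integral_indep _ _ _ _ _ _ _ P Y (X t)) => // A B mA mB.
apply: (@indep_generated _ _ _ _ _ _ _ P Y (X t) (past_cylinders X t)) => //.
- exact: past_cylinders_setI.
- exact: past_cylinders_setT.
- by move=> C D GC mD; exact: indep_past.
Qed.

(** Adaptedness of the iterates, by induction: [w t.+1] depends only on [w t] and [X t], and the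
    gradient term is a Carathéodory function of the two. *)
Lemma measurable_sgd (R : realType) (d : nat) (dO dT : measure_display)
  (Omega : measurableType dO) (T : measurableType dT)
  (X : nat -> Omega -> T) (g : 'rV[R]_d -> T -> 'rV[R]_d)
  (mg : forall v i, measurable_fun setT (fun x => g v x 0 i))
  (cg : forall x i, continuous (fun v => g v x 0 i))
  (eta : nat -> R) (w0 : 'rV[R]_d) (w : nat -> Omega -> 'rV[R]_d)
  (w_init : forall om, w 0%N om = w0)
  (w_step : forall t om, w t.+1 om = w t om - eta t *: g (w t om) (X t om))
  (t : nat) (i : 'I_d) :
  measurable_fun [set: g_sigma_algebraType (past_cylinders X t)]
    (fun om => w t om 0 i).
Proof.
elim: t i => [|t IH] i.
  by under eq_fun do rewrite w_init; exact: measurable_cst.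
under eq_fun do rewrite w_step !mxE.
apply: measurable_funB; first exact: measurable_fun_pastS.
apply: measurable_funM => //.
apply: (@measurable_carath _ _ _ _ _ _ (fun v x => g v x 0 i)) => //.
  by move=> j; exact: measurable_fun_pastS.
exact: measurable_past.
Qed.

(* [integral_pushforward] without its integrability hypothesis. *)
Lemma integral_distributionE (R : realType) (d d' : measure_display)
  (Om : measurableType d) (T : measurableType d') (P : probability Om R)
  (X : {RV P >-> T}) (h : T -> R) :
  measurable_fun setT h ->
  (\int[distribution P X]_x (h x)%:E = \int[P]_om (h (X om))%:E)%E.
Proof.
move=> mh; have mhE : measurable_fun setT (EFin \o h) by exact/measurable_EFinP.
rewrite integralE [RHS]integralE.
rewrite !ge0_integral_pushforward//.
- by congr (_ - _)%E; rewrite preimage_setT; apply: eq_integral => om _;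
    rewrite /= ?funeposE ?funenegE.
- exact: measurable_funeneg.
- exact: measurable_funepos.
Qed.

(** * Mean-square convergence of SGD *)

Theorem theorem9 (R : realType) (d : nat)
  (dO dT : measure_display)
  (Omega : measurableType dO) (T : measurableType dT)
  (P : probability Omega R)
  (xi : {RV P >-> T}) (xis : nat -> {RV P >-> T})
  (xis_iid : iid_copies xis xi)
  (f : 'rV[R]_d -> T -> R) (F : 'rV[R]_d -> R)
  (f_meas : forall w : 'rV[R]_d, measurable_fun [set: T] (f w))
  (f_diff : forall (x : T) (w : 'rV[R]_d), differentiable (fun v => f v x) w)
  (F_E : forall w : 'rV[R]_d, (F w)%:E = 'E_P[fun om => f w (xi om)]%E)
  (F_diff : forall w : 'rV[R]_d, differentiable F w)
  (gradF_E : forall (w : 'rV[R]_d) (i : 'I_d),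
     'E_P[fun om => (grad (fun v => f v (xi om)) w 0 i)%R]%E = (grad F w 0 i)%:E)
  (mu L : R) (mu_gt0 : 0 < mu) (L_gt0 : 0 < L)
  (F_sc : strongly_convex mu F)
  (f_smooth : forall x : T, smooth L (fun v => f v x))
  (f_convex : forall x : T, grad_convex (fun v => f v x))
  (ws : 'rV[R]_d) (ws_min : forall w : 'rV[R]_d, F ws <= F w)
  (N_fin :
     (2%:E * 'E_P[fun om => (enorm (grad (fun v => f v (xi om)) ws) ^+ 2)%R]
      < +oo)%E)
  (eta deta : R -> R)
  (eta_gt0 : forall t : R, 0 <= t -> 0 < eta t)
  (eta_deriv : forall t : R, 0 <= t ->
     has_derivative_within `[0, +oo[ eta t (deta t))
  (deta_le0 : forall t : R, 0 <= t -> deta t <= 0)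
  (eta_le : forall t : nat, eta t%:R <= 1 / (2 * L))
  (eta_to0 : eta t%:R @[t --> \oo] --> (0 : R))
  (eta_sum : (\sum_(0 <= t <oo) (eta t%:R)%:E = +oo)%E)
  (w0 : 'rV[R]_d) (w : nat -> Omega -> 'rV[R]_d)
  (w_init : forall om : Omega, w 0%N om = w0)
  (w_step : forall (t : nat) (om : Omega),
     w t.+1 om = w t om - eta t%:R *: grad (fun v => f v (xis t om)) (w t om)) :
  ('E_P[fun om => (enorm (w t.+1 om - ws) ^+ 2)%R]%E @[t --> \oo] --> 0)%E.
Proof.
have [xis_ind xis_dist] := xis_iid.
pose g v x := grad (f ^~ x) v.
have mg v i : measurable_fun setT (fun x => g v x 0 i) by exact: measurable_grad.
have cg x i : continuous (fun v => g v x 0 i).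
  exact: smooth_grad_continuous L_gt0 (f_smooth x).
have eta0 t : 0 < eta t%:R by exact: eta_gt0.
pose Q : probability T R := distribution P xi.
have mgs : measurable_fun setT (fun x => (enorm (g ws x) ^+ 2)%:E).
  by apply/measurable_EFinP; exact: measurable_enorm_sqr.
(* Here [q] is N/2; it is finite because an infinite integral would make its double infinite too. *)
have [q qE] : exists q, (\int[Q]_x (enorm (g ws x) ^+ 2)%:E = q%:E)%E.
  exists (fine (\int[Q]_x (enorm (g ws x) ^+ 2)%:E)%E).
  have sqr0 x : (0 <= (enorm (g ws x) ^+ 2)%:E)%E by rewrite lee_fin sqr_ge0.
  rewrite fineK// ge0_fin_numE; last by apply: integral_ge0.
  rewrite ge0_integral_pushforward//.
  rewrite ltNge leye_eq; apply/eqP => NE; move: N_fin.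
  by rewrite unlock NE gt0_muley// lte_fin.
have q0 : 0 <= q.
  by rewrite -lee_fin -qE; apply: integral_ge0 => x _; rewrite lee_fin sqr_ge0.
have gradFE v i : (\int[Q]_x (g v x 0 i)%:E = (grad F v 0 i)%:E)%E.
  rewrite -gradF_E unlock; exact: integral_distributionE.
(* Strong convexity at the pair ([ws], [v]), whose left side [F ws - F v] is at most 0 by
   minimality. *)
have gradF_ws v : mu / 2 * enorm (v - ws) ^+ 2 <= dot (v - ws) (grad F v).
  have := F_sc ws v; rewrite -(opprB v ws) enormN.
  have -> : dot (grad F v) (- (v - ws)) = - dot (v - ws) (grad F v).
    by rewrite /dot -sumrN; apply: eq_bigr => i _; rewrite !mxE; ring.
  have := ws_min v; lra.
have mw t i : measurable_fun [set: g_sigma_algebraType (past_cylinders xis t)]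
    (fun om => w t om 0 i).
  exact: (measurable_sgd (g := g) mg cg w_init w_step).
have mwO t :
    measurable_fun [set: Omega] (fun om => (enorm (w t om - ws) ^+ 2)%:E).
  apply/measurable_EFinP/measurable_enorm_sqr => i.
  under eq_fun do rewrite !mxE.
  apply: measurable_funB => //.
  exact: (measurableT_comp (mw t i) (@measurable_past_id _ _ _ _ xis t)).
pose E t := (\int[P]_om (enorm (w t om - ws) ^+ 2)%:E)%E.
have E0 t : (0 <= E t)%E by apply: integral_ge0 => x _; rewrite lee_fin sqr_ge0.
(* The factor [c] is left free: a crude value gives finiteness of [E], a sharper one gives the
   limit. Its nonnegativity permits splitting the integral in the extended reals. *)
have step c t : 0 <= c ->
    1 - eta t%:R * mu + 2 * eta t%:R ^+ 2 * L ^+ 2 <= c ->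
    (E t.+1 <= c%:E * E t + (2 * eta t%:R ^+ 2 * q)%:E)%E.
  move=> c0 hc.
  pose S := g_sigma_algebraType (past_cylinders xis t).
  (* The first component carries the history and fixes the iterate; the second is the fresh
     sample. *)
  pose h (z : S * T) :=
    (enorm (w t z.1 - eta t%:R *: g (w t z.1) z.2 - ws) ^+ 2)%:E.
  have mh : measurable_fun setT h.
    apply/measurable_EFinP/measurable_enorm_sqr => i.
    apply: (@eq_measurable_fun _ _ _ _ _ (fun z : S * T =>
      w t z.1 0 i - eta t%:R * g (w t z.1) z.2 0 i - ws 0 i)).
      by move=> z _; rewrite !mxE.
    have mw1 j : measurable_fun [set: S * T] (fun z => w t z.1 0 j).
      exact: (measurableT_comp (mw t j) measurable_fst).
    apply: measurable_funB => //; apply: measurable_funB => //.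
    apply: measurable_funM => //.
    by apply: (@measurable_carath _ _ _ _ _ _ (fun v x => g v x 0 i)).
  have h0 z : (0 <= h z)%E by rewrite lee_fin sqr_ge0.
  have -> : E t.+1 = (\int[P]_om h (om, xis t om))%E.
    by apply: eq_integral => om _; rewrite w_step.
  rewrite integral_indep_past//.
  have mF : measurable_fun [set: S] (fubini_F (distribution P (xis t)) h).
    exact: measurable_fun_fubini_tonelli_F.
  have -> : (c%:E * E t + (2 * eta t%:R ^+ 2 * q)%:E =
      \int[P]_om (c%:E * (enorm (w t om - ws) ^+ 2)%:E +
                  (2 * eta t%:R ^+ 2 * q)%:E))%E.
    rewrite ge0_integralD//.
    - rewrite ge0_integralZl_EFin// ?integral_cst//= ?probability_setT ?mule1//.
      by move=> om _; rewrite lee_fin sqr_ge0.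
    - by move=> om _; rewrite -EFinM lee_fin mulr_ge0// sqr_ge0.
    - exact: measurable_funeM.
    - by move=> om _; rewrite lee_fin mulr_ge0// mulr_ge0// sqr_ge0.
  apply: ge0_le_integral => //.
  - by move=> om _; exact: integral_ge0.
  - exact: (measurableT_comp mF (@measurable_past_id _ _ _ _ xis t)).
  - by apply: emeasurable_funD => //; exact: measurable_funeM.
  - move=> om _; rewrite -EFinM -EFinD.
    have -> : (\int[distribution P (xis t)]_y h (om, y) =
        \int[Q]_y h (om, y))%E.
      by apply: eq_measure_integral => A mA _; exact: xis_dist.
    have gL x : enorm (g (w t om) x - g ws x) <= L * enorm (w t om - ws).
      exact: f_smooth.
    have := @mean_sgd_step _ _ _ _ Q g ws _ _ L (eta t%:R) q mg gL qE (gradFE _).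
    move=> /le_trans; apply.
    have e0 : 0 <= 2 * eta t%:R by rewrite mulr_ge0// ltW.
    have := ler_wpM2l e0 (gradF_ws (w t om)).
    have := ler_wpM2r (sqr_ge0 (enorm (w t om - ws))) hc.
    rewrite lee_fin; lra.
(* Induction from the deterministic start; dropping the negative term [- eta t%:R * mu] gives a
   factor that is nonnegative for every step size. *)
have Efin t : E t \is a fin_num.
  rewrite ge0_fin_numE//; elim: t => [|t IH].
    rewrite /E; under eq_integral do rewrite w_init.
    by rewrite integral_cst//= probability_setT mule1 ltry.
  have c0 : 0 <= 2 * eta t%:R ^+ 2 * L ^+ 2.
    by rewrite mulr_ge0 ?sqr_ge0// mulr_ge0 ?sqr_ge0.
  have emu : 0 < eta t%:R * mu by rewrite mulr_gt0.
  apply: le_lt_trans (step (1 + 2 * eta t%:R ^+ 2 * L ^+ 2) t _ _) _.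
  - lra.
  - lra.
  - by rewrite lte_add_pinfty ?ltry// lte_mul_pinfty// ?lee_fin; lra.
pose a t := fine (E t).
have aE t : E t = (a t)%:E by rewrite fineK.
have acvg : a t @[t --> \oo] --> (0 : R).
  apply: (@divergent_series_contraction _ a (fun t => eta t%:R) (mu / 2)
    (2 * q)) => //.
  - by rewrite divr_gt0.
  - by move=> t; rewrite fine_ge0.
  near=> t.
  (* The first threshold makes 1 - (mu/2) eta nonnegative; the second makes 2 L^2 eta^2 at most
     (mu/2) eta, absorbing half of the contraction. *)
  have h1 : `|0 - eta t%:R| <= 1 / mu.
    by near: t; apply: cvgr_dist_le => //; rewrite divr_gt0.
  have h2 : `|0 - eta t%:R| <= mu / (4 * L ^+ 2).
    near: t; apply: cvgr_dist_le => //.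
    by rewrite divr_gt0// mulr_gt0// exprn_gt0.
  move: h1 h2; rewrite sub0r normrN gtr0_norm// => h1 h2.
  rewrite ler_pdivlMr// in h1; rewrite ler_pdivlMr ?mulr_gt0 ?exprn_gt0// in h2.
  have -> : eta t%:R ^+ 2 * (2 * q) = 2 * eta t%:R ^+ 2 * q by ring.
  rewrite -lee_fin EFinD EFinM -!aE; apply: step; first by lra.
  have := ler_wpM2l (ltW (eta0 t)) h2; lra.
under eq_cvg do rewrite unlock -/(E _.+1) aE.
apply/cvg_EFin; first by near=> t.
by rewrite (cvg_shiftS a).
Unshelve. all: by end_near. Qed.
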